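(* Let $d\ge2$, let $U$ be a dual-unitary gate on $\mathbb C^d\otimes\mathbb C^d$, and suppose it is charged: there are two families $\{\Pi^{\mathrm L}_\beta\}_{\beta}$ and $\{\Pi^{\mathrm R}_\alpha\}_{\alpha}$ of mutually orthogonal projectors on $\mathbb C^d$ with $$\sum_\beta\Pi^{\mathrm L}_\beta=\mathbb 1_d=\sum_\alpha\Pi^{\mathrm R}_\alpha,\qquad U(\Pi^{\mathrm R}_\alpha\otimes\Pi^{\mathrm L}_\beta)=(\Pi^{\mathrm L}_\beta\otimes\Pi^{\mathrm R}_\alpha)U\quad\text{for all }\alpha,\beta .$$ Consider the brickwork circuit built from $U$, started from the Bell-pair state, and let $\rho_A$ be the reduced density matrix at time $t$ of the subsystem $A$ made of two intervals of $2\ell$ qudits each separated by $2x$ qudits, where $\ell,x,t$ are positive integers with $x>\ell$. If $x/2<t<x/2+\ell$, then $$S[\rho_A]\le 4\ell\log d-\big(\ell-|2t-(x+\ell)|\big)\,I_{\mathrm L:\mathrm R},$$ where $S[\rho]=-\mathrm{tr}[\rho\log\rho]$ and $I_{\mathrm L:\mathrm R}$ is the classical mutual information between left- and right-moving charges for the probability distribution $c_{\alpha,\beta}$ they define on the initial state.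
   Context: Dual-unitarity: $U$ is unitary and the matrix $\widetilde U$ defined by $\langle ij|\widetilde U|kl\rangle=\langle jl|U|ik\rangle$ is also unitary. Circuit. There are $2L$ qudits (copies of $\mathbb C^d$) at positions in $\tfrac12\mathbb Z$ modulo $L$ (periodic boundary conditions). $U_{a,b}$ acts as $U$ on the qudits at $a$ (first factor) and $b$ (second factor). One time step is $\mathbb U=\mathbb U_e\mathbb U_o$ with $\mathbb U_e=\bigotimes_{y=1}^{L}U_{y,y+1/2}$ and $\mathbb U_o=\bigotimes_{y=0}^{L-1}U_{y+1/2,y+1}$. The initial state is $|\Psi_0\rangle=\bigotimes_{y=1}^L|\psi_0\rangle_{y,y+1/2}$ with $|\psi_0\rangle=d^{-1/2}\sum_{i=1}^d|i\rangle|i\rangle$. The subsystem is $A=\{1,\tfrac32,\dots,\ell,\ell+\tfrac12\}\cup\{\ell+x+1,\ell+x+\tfrac32,\dots,2\ell+x,2\ell+x+\tfrac12\}$, and $\rho_A$ is the reduced density matrix on $A$ of $\mathbb U^t|\Psi_0\rangle$. Standing convention: $L$ is much larger than all other quantities ($L\ge4(\ell+x+t)$, say). Charge distribution: $c_{\alpha,\beta}=\langle\psi_0|\Pi^{\mathrm L}_\alpha\otimes\Pi^{\mathrm R}_\beta|\psi_0\rangle\ge0$ (first index: left-moving charge, second index: right-moving charge), with marginals $c^{\mathrm L}_\alpha=\sum_\beta c_{\alpha,\beta}=\mathrm{tr}[\Pi^{\mathrm L}_\alpha]/d$ and $c^{\mathrm R}_\beta=\sum_\alpha c_{\alpha,\beta}=\mathrm{tr}[\Pi^{\mathrm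 R}_\beta]/d$. The mutual information is $$I_{\mathrm L:\mathrm R}=\sum_{\alpha,\beta}c_{\alpha,\beta}\log c_{\alpha,\beta}-\sum_\alpha c^{\mathrm L}_\alpha\log c^{\mathrm L}_\alpha-\sum_\beta c^{\mathrm R}_\beta\log c^{\mathrm R}_\beta,$$ with $0\log0=0$. *)

(* Defs.v *)
From mathcomp Require Import all_boot all_order all_algebra.
From mathcomp Require Import spectral.
From mathcomp Require Import reals exp.
From mathcomp Require Import complex mxtens.

Set Implicit Arguments.
Unset Strict Implicit.
Unset Printing Implicit Defensive.

Import Order.TTheory GRing.Theory Num.Theory.
Local Open Scope ring_scope.
Local Open Scope complex_scope.
Local Open Scope sesquilinear_scope.

(** * Entropy *)

(* Matrix logarithm of a positive semidefinite matrix, by functional calculus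
   on a spectral decomposition.  Since [ln 0 = 0], the product
   [rho *m logmx rho] follows the convention 0 log 0 = 0. *)
Definition logmx (R : realType) (n : nat) (A : 'M[R[i]]_n) : 'M[R[i]]_n :=
  invmx (spectralmx A)
  *m diag_mx (map_mx (fun z : R[i] => (ln (complex.Re z))%:C) (spectral_diag A))
  *m spectralmx A.

Definition vN_entropy (R : realType) (n : nat) (rho : 'M[R[i]]_n) : R :=
  - complex.Re (\tr (rho *m logmx rho)).

Definition mutual_info (R : realType) (I J : finType) (c : I -> J -> R) : R :=
  let cL a := \sum_b c a b in
  let cR b := \sum_a c a b in
  \sum_a \sum_b c a b * ln (c a b)
  - \sum_a cL a * ln (cL a)
  - \sum_b cR b * ln (cR b).

(** * Two-qudit gates and charges *)

(* Operators on C^d (x) C^d are matrices indexed by [mxtens_index (i, j)], the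
   index of the product ket |i j> used by the Kronecker product [*t];
   [ent2 M i j k l] is the matrix element <i j| M |k l>. *)
Definition ent2 (C : Type) (d : nat) (M : 'M[C]_(d * d))
    (i j k l : 'I_d) : C :=
  M (mxtens_index (i, j)) (mxtens_index (k, l)).

Definition dual_gate (C : Type) (d : nat) (U : 'M[C]_(d * d)) : 'M[C]_(d * d) :=
  \matrix_(p, q)
    let: (i, j) := mxtens_unindex p in
    let: (k, l) := mxtens_unindex q in
    ent2 U j l i k.

Definition dual_unitary (R : realType) (d : nat) (U : 'M[R[i]]_(d * d)) : Prop :=
  U \is unitarymx /\ dual_gate U \is unitarymx.

(* Mutually orthogonal (Hermitian) projectors summing to the identity.  Zero
   projectors are allowed. *)
Definition projector_resolution (R : realType) (d : nat) (I : finType)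
    (P : I -> 'M[R[i]]_d) : Prop :=
  [/\ forall a, (P a) ^t* = P a,
      forall a, P a *m P a = P a,
      forall a b, a != b -> P a *m P b = 0
    & \sum_a P a = 1%:M].

Definition charged_gate (R : realType) (d : nat) (IL IR : finType)
    (U : 'M[R[i]]_(d * d)) (PL : IL -> 'M[R[i]]_d) (PR : IR -> 'M[R[i]]_d)
    : Prop :=
  [/\ projector_resolution PL,
      projector_resolution PR
    & forall a b, U *m (PR a *t PL b) = (PL b *t PR a) *m U].

(* The Bell pair d^(-1/2) sum_i |i>|i>. *)
Definition bell (R : realType) (d : nat) : 'cV[R[i]]_(d * d) :=
  ((Num.sqrt d%:R)^-1)%:C *:
    \sum_(i < d) delta_mx (mxtens_index (i, i)) 0.

Definition charge_distr (R : realType) (d : nat) (IL IR : finType)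
    (PL : IL -> 'M[R[i]]_d) (PR : IR -> 'M[R[i]]_d) (a : IL) (b : IR) : R :=
  complex.Re (((bell R d) ^t* *m (PL a *t PR b) *m bell R d) 0 0).

(** * The brickwork circuit *)

(* The qudit at position y in (1/2)Z modulo L is labelled by
   k = 2y : 'I_(L.*2): integer positions are the even labels, and the right
   neighbour y + 1/2 is [ordS k], cyclically.  A basis ket of S qudits is a
   configuration S -> 'I_d; operators are matrices indexed by
   [enum_rank s]. *)
Notation config S d := {ffun S -> 'I_d}.

(* The tensor product of the two-qudit operators [U] acting on the pairs
   (k, ordS k), for all labels k satisfying [P].  This is meant for [P] the even
   or the odd labels, for which these pairs partition the chain. *)
Definition layer (R : realType) (d L : nat) (U : 'M[R[i]]_(d * d))
    (P : pred 'I_(L.*2)) : 'M[R[i]]_#|config 'I_(L.*2) d| :=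
  \matrix_(p, q)
    let s : config 'I_(L.*2) d := enum_val p in
    let s' : config 'I_(L.*2) d := enum_val q in
    \prod_(k | P k) ent2 U (s k) (s (ordS k)) (s' k) (s' (ordS k)).

Definition brickwork (R : realType) (d L : nat) (U : 'M[R[i]]_(d * d))
    : 'M[R[i]]_#|config 'I_(L.*2) d| :=
  layer U (fun k => ~~ odd k) *m layer U (fun k => odd k).

Definition initial_state (R : realType) (d L : nat)
    : 'cV[R[i]]_#|config 'I_(L.*2) d| :=
  \col_p
    let s : config 'I_(L.*2) d := enum_val p in
    \prod_(k : 'I_(L.*2) | ~~ odd k)
      bell R d (mxtens_index (s k, s (ordS k))) 0.

Definition evolved_state (R : realType) (d L : nat) (U : 'M[R[i]]_(d * d))
    (t : nat) : 'cV[R[i]]_#|config 'I_(L.*2) d| :=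
  brickwork L U ^+ t *m initial_state R d L.

(** * Reduced density matrices *)

Definition restr (S : finType) (d : nat) (A : {set S}) (s : config S d)
    : config {k : S | k \in A} d :=
  [ffun k => s (val k)].

Definition partial_trace (R : realType) (S : finType) (d : nat) (A : {set S})
    (rho : 'M[R[i]]_#|config S d|)
    : 'M[R[i]]_#|config {k : S | k \in A} d| :=
  \matrix_(p, q)
    \sum_(s : config S d | restr A s == enum_val p)
      \sum_(s' : config S d | (restr A s' == enum_val q)
                              && (restr (~: A) s == restr (~: A) s'))
        rho (enum_rank s) (enum_rank s').

Definition reduced_state (R : realType) (d L : nat) (U : 'M[R[i]]_(d * d))
    (t : nat) (A : {set 'I_(L.*2)})
    : 'M[R[i]]_#|config {k : 'I_(L.*2) | k \in A} d| :=
  let psi := evolved_state L U t in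
  partial_trace A (psi *m psi ^t*).

(* Positions 1, ..., l + 1/2 and l + x + 1, ..., 2l + x + 1/2. *)
Definition two_intervals (L l x : nat) : {set 'I_(L.*2)} :=
  [set k : 'I_(L.*2) | (2 <= k <= l.*2.+1)%N
                    || ((l + x + 1).*2 <= k <= (2 * l + x).*2.+1)%N].

(* Main.v *)
(* In each layer a charged gate moves a projector PiR one site to the right and
   a projector PiL one site to the left, so in the Heisenberg picture local
   charges are solitons.  Let n = l - |2t - (x + l)|: exactly n of the initial
   Bell pairs have, at time t, their left mover in the first interval and their
   right mover in the second one.  The charges of these 2n qudits can be
   measured inside A, and transporting the projectors back to time 0 shows that
   the outcomes of the n pairs are independent with law c.  Pinching then bounds
   S[rho_A] by sum_f p_f (ln D_f - ln p_f), with p_f the probability of the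
   outcome f and D_f = d^|A| prod_j cL cR the rank of its projector; this sum
   equals |A| ln d - n I. *)
Require Import Defs.
From mathcomp Require Import all_boot all_order all_algebra.
From mathcomp Require Import spectral.
From mathcomp Require Import reals exp.
From mathcomp Require Import complex mxtens.
From mathcomp Require Import zify ring lra.

Set Implicit Arguments.
Unset Strict Implicit.
Unset Printing Implicit Defensive.

Import Order.TTheory GRing.Theory Num.Theory.
Local Open Scope ring_scope.
Local Open Scope complex_scope.
Local Open Scope sesquilinear_scope.

(** * Entropy under a projective measurement *)

Section Entropy.
Variable R : realType.
Implicit Types (x q : R).

(** The graph of the convex function $x\ln x$ lies above its tangent at $q$. For $x>0$ this is
    $\ln(1+y)\le y$ at $y=q/x-1$, multiplied by $x$. *)
Lemma subr_le_xlnx x q : 0 <= x -> 0 < q -> x - q <= x * ln x - x * ln q.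
Proof.
rewrite le_eqVlt => /predU1P[<-|x0] q0; first by rewrite !mul0r; lra.
have qx0 : 0 < q / x by rewrite divr_gt0.
have := @le_ln1Dx R (q / x - 1).
rewrite ltrBDr addNr qx0 => /(_ isT).
rewrite addrCA subrr addr0 ln_div ?posrE// => h.
have := ler_wpM2l (ltW x0) h.
by rewrite !mulrBr mulrCA divff ?gt_eqF//; lra.
Qed.

(* Jensen's inequality for [x ln x] with the weights [a^~ c], for each [c]. *)
Lemma coarse_entropy_le (I C : finType) (lam : I -> R) (a : I -> C -> R)
    (p D : C -> R) :
  (forall i, 0 <= lam i) -> (forall i c, 0 <= a i c) ->
  (forall i, \sum_c a i c = 1) ->
  (forall c, p c = \sum_i lam i * a i c) -> (forall c, D c = \sum_i a i c) ->
  - \sum_i lam i * ln (lam i) <= \sum_c p c * (ln (D c) - ln (p c)).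
Proof.
move=> lam0 a0 a1 pE DE.
rewrite -[leLHS]sumrN (eq_bigr (fun i => \sum_c - (lam i * a i c * ln (lam i)))).
  rewrite exchange_big; apply: ler_sum => c _.
  have p_ge0 : 0 <= p c by rewrite pE; apply: sumr_ge0 => i _; apply: mulr_ge0.
  have D_ge0 : 0 <= D c by rewrite DE; exact: sumr_ge0.
  have [pc0|pc_neq0] := eqVneq (p c) 0.
    rewrite pc0 mul0r; rewrite pE in pc0; rewrite big1// => i _.
    have /(_ i isT) -> := (psumr_eq0P (fun i _ => mulr_ge0 (lam0 i) (a0 i c)) pc0).
    by rewrite mul0r oppr0.
  have p_gt0 : 0 < p c by rewrite lt_def pc_neq0.
  have D_gt0 : 0 < D c.
    rewrite lt_def D_ge0 andbT; apply: contra_neq pc_neq0; rewrite DE pE => D0.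
    apply: big1 => i _.
    by have /(_ i isT) -> := (psumr_eq0P (fun i _ => a0 i c) D0); rewrite mulr0.
  rewrite sumrN lerNl -mulrN opprB -ln_div ?posrE//.
  have q_gt0 : 0 < p c / D c by rewrite divr_gt0.
  rewrite -subr_ge0.
  (* This sum vanishes, because [p c / D c] is the mean of [lam] with weights [a i c]; the tangent
     bound at that mean is then applied termwise. *)
  apply: (@le_trans _ _ (\sum_i a i c * (lam i - p c / D c))).
    under eq_bigr do rewrite mulrBr mulrC.
    by rewrite sumrB -mulr_suml -pE -DE mulrCA divff ?gt_eqF// mulr1 subrr.
  apply: (@le_trans _ _
    (\sum_i a i c * (lam i * ln (lam i) - lam i * ln (p c / D c)))).
    by apply: ler_sum => i _; apply: ler_wpM2l => //; apply: subr_le_xlnx.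
  rewrite [X in _ <= _ - X * _]pE mulr_suml -sumrB.
  by apply: ler_sum => i _; rewrite le_eqVlt; apply/orP; left; apply/eqP; ring.
by move=> i _; rewrite sumrN -mulr_suml -mulr_sumr a1 mulr1.
Qed.

Lemma mulmx_trmxC_ge0 m n (A : 'M[R[i]]_(m, n)) i : 0 <= (A *m A ^t*) i i.
Proof.
by rewrite mxE; apply: sumr_ge0 => k _; rewrite !mxE mul_conjC_ge0.
Qed.

(** The order on [R[i]] only compares numbers with equal imaginary parts, so nonnegativity includes
    being real. *)
Lemma complex_ge0E (z : R[i]) : 0 <= z -> z = (complex.Re z)%:C /\ 0 <= complex.Re z.
Proof. by case: z => a b; rewrite lecE /= => /andP[/eqP -> ->]. Qed.

Lemma mxtrace_unitary_conj n (V M : 'M[R[i]]_n) :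
  V \is unitarymx -> \tr (V *m M *m V ^t*) = \tr M.
Proof.
move=> Vu; rewrite mxtrace_mulC mulmxA -[X in \tr (X *m _)]mul1mx.
by rewrite mul1mx -(invmx_unitary Vu) mulVmx ?mul1mx// unitarymx_unit.
Qed.

(** In an eigenbasis of the state, the diagonal entries [a i c] of [P c] are nonnegative and sum to
    1 over [c]. Their sum over [i] is the trace of [P c], and their mean under the eigenvalues is
    the outcome probability, so Jensen's inequality applies. The form [B *m B ^t*] of the state
    gives positivity directly. *)
Lemma vN_entropy_le_measurement n m (B : 'M[R[i]]_(n, m)) (C : finType)
    (P : C -> 'M[R[i]]_n) (p D : C -> R) :
  (forall c, P c ^t* = P c) -> (forall c, P c *m P c = P c) ->
  \sum_c P c = 1%:M ->
  (forall c, \tr (B *m B ^t* *m P c) = (p c)%:C) ->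
  (forall c, \tr (P c) = (D c)%:C) ->
  vN_entropy (B *m B ^t*) <= \sum_c p c * (ln (D c) - ln (p c)).
Proof.
move=> Pherm Pidem P1 Bp PD; set rho := B *m B ^t* in Bp *.
have rhoB : rho = B *m B ^t* by [].
clearbody rho.
have rho_herm : rho ^t* = rho by rewrite rhoB trmx_mul map_mxM/= trmxCK.
have rho_normal : rho \is normalmx by apply/normalmxP; rewrite rho_herm.
have Vu := spectral_unitarymx rho.
set V := spectralmx rho in Vu *.
have rhoE : rho = invmx V *m diag_mx (spectral_diag rho) *m V.
  exact: (orthomx_spectralP rho_normal).
have VVt : V *m V ^t* = 1%:M by apply/unitarymxP.
have VtV : V ^t* *m V = 1%:M.
  by rewrite -(invmx_unitary Vu) mulVmx// unitarymx_unit.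
have diagE : V *m rho *m V ^t* = diag_mx (spectral_diag rho).
  rewrite [X in V *m X *m _]rhoE (invmx_unitary Vu) !mulmxA VVt mul1mx.
  by rewrite -mulmxA VVt mulmx1.
pose lam i := complex.Re (spectral_diag rho 0 i).
have lamP i : spectral_diag rho 0 i = (lam i)%:C /\ 0 <= lam i.
  apply: complex_ge0E.
  have -> : spectral_diag rho 0 i = (V *m rho *m V ^t*) i i.
    by rewrite diagE mxE eqxx.
  have -> : V *m rho *m V ^t* = (V *m B) *m (V *m B) ^t*.
    by rewrite rhoB trmx_mul map_mxM/= !mulmxA.
  exact: mulmx_trmxC_ge0.
pose a i c := complex.Re ((V *m P c *m V ^t*) i i).
have aP i c : (V *m P c *m V ^t*) i i = (a i c)%:C /\ 0 <= a i c.
  apply: complex_ge0E.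
  have -> : V *m P c *m V ^t* = (V *m P c) *m (V *m P c) ^t*.
    by rewrite trmx_mul map_mxM/= Pherm -!mulmxA (mulmxA (P c) (P c)) Pidem.
  exact: mulmx_trmxC_ge0.
have Cinj : injective (real_complex R) by exact: complexI.
have a1 i : \sum_c a i c = 1.
  apply: Cinj; rewrite rmorph_sum rmorph1.
  rewrite (eq_bigr (fun c => (V *m P c *m V ^t*) i i)); last first.
    by move=> c _; rewrite (aP _ _).1.
  by rewrite -summxE -mulmx_suml -mulmx_sumr P1 mulmx1 VVt mxE eqxx.
have DE c : D c = \sum_i a i c.
  apply: Cinj; rewrite rmorph_sum /= -PD -(mxtrace_unitary_conj _ Vu).
  by apply: eq_bigr => i _; rewrite (aP _ _).1.
have pE c : p c = \sum_i lam i * a i c.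
  apply: Cinj; rewrite rmorph_sum /= -Bp -(mxtrace_unitary_conj _ Vu).
  have -> : V *m (rho *m P c) *m V ^t* = (V *m rho *m V ^t*) *m (V *m P c *m V ^t*).
    by rewrite !mulmxA -(mulmxA (V *m rho) (V ^t* ) V) VtV mulmx1.
  rewrite diagE; apply: eq_bigr => i _.
  by rewrite mul_diag_mx mxE (aP _ _).1 (lamP _).1 rmorphM.
have -> : vN_entropy rho = - \sum_i lam i * ln (lam i).
  rewrite /vN_entropy /logmx -/V; congr (- _).
  rewrite -(mxtrace_unitary_conj _ Vu) (invmx_unitary Vu).
  rewrite -!mulmxA VVt mulmx1 !mulmxA diagE mulmx_diag mxtrace_diag.
  have -> : \sum_i lam i * ln (lam i) =
    complex.Re (\sum_i lam i * ln (lam i))%:C by [].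
  rewrite rmorph_sum; congr (complex.Re _); apply: eq_bigr => i _.
  by rewrite !mxE -/(lam i) (lamP i).1 rmorphM.
apply: (@coarse_entropy_le _ _ lam a) => //.
- by move=> i; case: (lamP i).
- by move=> i c; case: (aP i c).
Qed.

End Entropy.

(** * Tensor products of one-site operators *)

Section ProductOperators.
Variables (R : realType) (S : finType) (d : nat).
Local Notation C := R[i].
Local Notation conf := (config S d).
Implicit Types (M N : S -> 'M[C]_d).

Lemma sum_enum_val (V : nmodType) (F : conf -> V) :
  \sum_(p < #|conf|) F (enum_val p) = \sum_s F s.
Proof. by rewrite [RHS](reindex _ (onW_bij _ (@enum_val_bij _))). Qed.

(** The operator $\bigotimes_k M_k$ on the whole system. *)
Definition siteop M : 'M[C]_#|conf| :=
  \matrix_(p, q) \prod_k M k ((enum_val p : conf) k) ((enum_val q : conf) k).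

Lemma eq_siteop M N : M =1 N -> siteop M = siteop N.
Proof. by move=> MN; apply/matrixP => p q; rewrite !mxE; under eq_bigr do rewrite MN. Qed.

Lemma siteop_mul M N : siteop M *m siteop N = siteop (fun k => M k *m N k).
Proof.
apply/matrixP => p q; rewrite [LHS]mxE [RHS]mxE.
under [LHS]eq_bigr do rewrite !mxE -big_split /=.
rewrite (sum_enum_val (fun s => \prod_k (M k ((enum_val p : conf) k) (s k)
  * N k (s k) ((enum_val q : conf) k)))).
by under [RHS]eq_bigr do rewrite mxE; rewrite bigA_distr_bigA.
Qed.

Lemma siteop_trmxC M : siteop M ^t* = siteop (fun k => M k ^t*).
Proof.
by apply/matrixP => p q; rewrite !mxE rmorph_prod; apply: eq_bigr => k _; rewrite !mxE.
Qed.

Lemma prod_delta (s s' : conf) : \prod_k (s k == s' k)%:R = (s == s')%:R :> C.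
Proof.
have [->|ss'] := eqVneq s s'; first by rewrite big1// => k _; rewrite eqxx.
have [k sk] : exists k, s k != s' k.
  apply/existsP; rewrite -negb_forall; apply: contra ss' => /forallP e.
  by apply/eqP/ffunP => k; apply/eqP.
by rewrite (bigD1 k)//= (negbTE sk) mul0r.
Qed.

Lemma siteop1 : siteop (fun=> 1%:M) = 1%:M.
Proof.
apply/matrixP => p q; rewrite !mxE; under eq_bigr do rewrite mxE.
by rewrite prod_delta (inj_eq enum_val_inj).
Qed.

Lemma mxtrace_siteop M : \tr (siteop M) = \prod_k \tr (M k).
Proof.
rewrite bigA_distr_bigA -sum_enum_val.
by apply: eq_bigr => p _; rewrite mxE.
Qed.

Lemma tensmx1 : (1%:M : 'M[C]_d) *t (1%:M : 'M[C]_d) = 1%:M.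
Proof.
apply/matrixP => p q; case: (mxtens_indexP p) => i j; case: (mxtens_indexP q) => k l.
rewrite tensmxE !mxE (can_eq (@mxtens_indexK _ _)) xpair_eqE -natrM.
by rewrite mulnb.
Qed.

(** * Layers of two-site operators on a perfect pairing of the sites *)

Section Pairing.
Variables (P : pred S) (nx pv : S -> S).
Hypotheses (nxK : cancel nx pv) (pvK : cancel pv nx).
Hypotheses (Pnx : forall k, P (nx k) = ~~ P k) (d_gt0 : (0 < d)%N).

Lemma prod_pairs (F : S -> C) : \prod_k F k = \prod_(k | P k) (F k * F (nx k)).
Proof.
rewrite (bigID P) big_split /=; congr (_ * _).
rewrite (reindex nx); first by apply: eq_bigl => k; rewrite Pnx negbK.
by exists pv => k _.
Qed.

(** Each site lies in exactly one pair, so a configuration is the same as a family of value pairs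
    indexed by [P], and the sum distributes over the product. *)
Lemma sum_pairs (F : S -> 'I_d -> 'I_d -> C) :
  \sum_(s : conf) \prod_(k | P k) F k (s k) (s (nx k)) =
  \prod_(k | P k) \sum_i \sum_j F k i j.
Proof.
(* Default value: [big_distr_big] sums over finite functions on all of [S] that equal [j0] outside
   [P]. *)
pose j0 := (Ordinal d_gt0, Ordinal d_gt0).
under [RHS]eq_bigr do rewrite pair_bigA /=.
rewrite (big_distr_big j0).
pose h (s : conf) : {ffun S -> 'I_d * 'I_d} :=
  [ffun k => if P k then (s k, s (nx k)) else j0].
pose h' (f : {ffun S -> 'I_d * 'I_d}) : conf :=
  [ffun k => if P k then (f k).1 else (f (pv k)).2].
have hK s : h' (h s) = s.
  apply/ffunP => k; rewrite !ffunE; case Pk : (P k) => //=.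
  by rewrite -(negbK (P (pv k))) -Pnx pvK Pk.
rewrite (reindex_onto h h') => /= [|f /pffun_onP[fP _]]; last first.
  apply/ffunP => k; rewrite !ffunE; case Pk : (P k); last first.
    by apply/esym/eqP; apply: contraFT Pk => fk; apply: (subsetP fP); rewrite inE.
  by rewrite Pnx Pk nxK -surjective_pairing.
apply: eq_big => [s|s _]; last by apply: eq_bigr => k Pk; rewrite ffunE Pk.
rewrite hK eqxx andbT; apply/esym/pffun_onP; split=> //.
by apply/subsetP => k; rewrite inE ffunE; case: ifP => // _; rewrite eqxx.
Qed.

(** Version of [layer] whose gate depends on the pair, hence closed under products and adjoints; a
    constant family on the chain unfolds to [layer]. *)
Definition gatelayer (G : S -> 'M[C]_(d * d)) : 'M[C]_#|conf| :=
  \matrix_(p, q) let s : conf := enum_val p in let s' : conf := enum_val q in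
    \prod_(k | P k) ent2 (G k) (s k) (s (nx k)) (s' k) (s' (nx k)).

Definition pairstate (v : S -> 'cV[C]_(d * d)) : 'cV[C]_#|conf| :=
  \col_p let s : conf := enum_val p in
    \prod_(k | P k) v k (mxtens_index (s k, s (nx k))) 0.

Lemma sum_mxtens (F : 'I_(d * d) -> C) :
  \sum_i \sum_j F (mxtens_index (i, j)) = \sum_p F p.
Proof.
rewrite pair_bigA /= [RHS](reindex (@mxtens_index d d)) /=.
  by apply: eq_bigr => -[].
by exists (@mxtens_unindex d d) => k _; rewrite ?mxtens_indexK ?mxtens_unindexK.
Qed.

Lemma gatelayer_mul G H :
  gatelayer G *m gatelayer H = gatelayer (fun k => G k *m H k).
Proof.
apply/matrixP => p q; rewrite [LHS]mxE [RHS]mxE.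
under [LHS]eq_bigr do rewrite !mxE -big_split /=.
set s := enum_val p; set s' := enum_val q.
rewrite (sum_enum_val (fun r => \prod_(k | P k)
  (ent2 (G k) (s k) (s (nx k)) (r k) (r (nx k)) *
   ent2 (H k) (r k) (r (nx k)) (s' k) (s' (nx k))))).
rewrite (sum_pairs (fun k i j => ent2 (G k) (s k) (s (nx k)) i j *
   ent2 (H k) i j (s' k) (s' (nx k)))).
apply: eq_bigr => k _; rewrite /ent2 mxE.
exact: (sum_mxtens (fun m => G k _ m * H k m _)).
Qed.

Lemma gatelayer_mul_pairstate G v :
  gatelayer G *m pairstate v = pairstate (fun k => G k *m v k).
Proof.
apply/matrixP => p q; rewrite [LHS]mxE [RHS]mxE.
under [LHS]eq_bigr do rewrite !mxE -big_split /=.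
set s := enum_val p.
rewrite (sum_enum_val (fun r => \prod_(k | P k)
  (ent2 (G k) (s k) (s (nx k)) (r k) (r (nx k)) *
   v k (mxtens_index (r k, r (nx k))) 0))).
rewrite (sum_pairs (fun k i j => ent2 (G k) (s k) (s (nx k)) i j *
   v k (mxtens_index (i, j)) 0)).
apply: eq_bigr => k _; rewrite /ent2 mxE.
exact: (sum_mxtens (fun m => G k _ m * v k m 0)).
Qed.

Lemma pairstate_dot v w :
  ((pairstate v) ^t* *m pairstate w) 0 0 =
  \prod_(k | P k) ((v k) ^t* *m w k) 0 0.
Proof.
rewrite mxE.
under [LHS]eq_bigr do rewrite !mxE rmorph_prod -big_split /=.
rewrite (sum_enum_val (fun r => \prod_(k | P k)
  ((v k (mxtens_index (r k, r (nx k))) 0)^* *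
   w k (mxtens_index (r k, r (nx k))) 0))).
rewrite (sum_pairs (fun k i j => (v k (mxtens_index (i, j)) 0)^* *
   w k (mxtens_index (i, j)) 0)).
apply: eq_bigr => k _; rewrite mxE.
rewrite (sum_mxtens (fun m => (v k m 0)^* * w k m 0)).
by apply: eq_bigr => m _; rewrite !mxE.
Qed.

Lemma gatelayer_trmxC G : gatelayer G ^t* = gatelayer (fun k => G k ^t*).
Proof.
apply/matrixP => p q; rewrite !mxE rmorph_prod.
by apply: eq_bigr => k _; rewrite /ent2 !mxE.
Qed.

(** Seeing a one-site product as a layer lets commutation with a layer of gates be checked on each
    pair separately. *)
Lemma siteopE M : siteop M = gatelayer (fun k => M k *t M (nx k)).
Proof.
apply/matrixP => p q; rewrite !mxE prod_pairs.
by apply: eq_bigr => k _; rewrite /ent2 tensmxE.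
Qed.

Lemma eq_gatelayer G H : (forall k, P k -> G k = H k) -> gatelayer G = gatelayer H.
Proof.
by move=> GH; apply/matrixP => p q; rewrite !mxE; apply: eq_bigr => k /GH ->.
Qed.

Lemma gatelayer_isometry (U : 'M[C]_(d * d)) : U \is unitarymx ->
  gatelayer (fun=> U) ^t* *m gatelayer (fun=> U) = 1%:M.
Proof.
move=> Uu; rewrite gatelayer_trmxC gatelayer_mul -siteop1 siteopE.
apply: eq_gatelayer => k _.
by rewrite -(invmx_unitary Uu) mulVmx ?unitarymx_unit// tensmx1.
Qed.

Lemma gatelayer_intertwine (U : 'M[C]_(d * d)) M N :
  (forall k, P k -> U *m (M k *t M (nx k)) = (N k *t N (nx k)) *m U) ->
  gatelayer (fun=> U) *m siteop M = siteop N *m gatelayer (fun=> U).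
Proof.
by move=> UMN; rewrite !siteopE !gatelayer_mul; apply: eq_gatelayer => k /UMN.
Qed.

End Pairing.
End ProductOperators.

(** * Operators placed at an injective family of sites *)

Section PlacedOperators.
Variables (R : realType) (S J : finType) (d : nat).
Local Notation C := R[i].
Implicit Types (P : pred S) (g : J -> S) (T : J -> 'M[C]_d).

(** By injectivity [pick] returns the unique label of a site in the image of [g]. Keeping the label
    as an [option] lets [F] combine several operators attached to one label, as for the two ends of
    a Bell pair. *)
Lemma prod_pick P g (F : S -> option J -> C) :
  injective g -> (forall j, P (g j)) ->
  \prod_(k | P k) F k [pick j | g j == k] =
  \prod_j F (g j) (Some j) * \prod_(k | P k && (k \notin codom g)) F k None.
Proof.
move=> g_inj Pg; rewrite (bigID (mem (codom g))) /=; congr (_ * _); last first.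
  apply: eq_bigr => k /andP[_ kg]; case: pickP => // j /eqP jk.
  by rewrite -jk codom_f in kg.
have pickg j : [pick j' | g j' == g j] = Some j.
  case: pickP => [j' /eqP/g_inj ->//|/(_ j)]; by rewrite eqxx.
rewrite (reindex_omap g (fun k => [pick j | g j == k])) /=; last first.
  move=> k /andP[_ /codomP[j ->]]; by rewrite pickg.
apply: eq_big => [j|j _]; last by rewrite pickg.
by rewrite Pg codom_f pickg eqxx.
Qed.

Definition place g T (k : S) : 'M[C]_d := oapp T 1%:M [pick j | g j == k].

Lemma place1 g k : place g (fun=> 1%:M) k = 1%:M.
Proof. by rewrite /place; case: pickP. Qed.

Lemma place_out g T k : (forall j, g j != k) -> place g T k = 1%:M.
Proof. by move=> gk; rewrite /place; case: pickP => // j; rewrite (negbTE (gk j)). Qed.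

Lemma prod_place P g T (F : S -> 'M[C]_d -> C) :
  injective g -> (forall j, P (g j)) ->
  \prod_(k | P k) F k (place g T k) =
  \prod_j F (g j) (T j) * \prod_(k | P k && (k \notin codom g)) F k 1%:M.
Proof. exact: (prod_pick (fun k => F k \o oapp T 1%:M)). Qed.

End PlacedOperators.

(** * Projectors onto the outcomes of the charge measurement *)

Section ChargeProjectors.
Variables (R : realType) (d : nat) (IL IR : finType).
Variables (PL : IL -> 'M[R[i]]_d) (PR : IR -> 'M[R[i]]_d).
Hypotheses (PLres : projector_resolution PL) (PRres : projector_resolution PR).
Variables (S J : finType) (P : pred S) (gL gR : J -> S).
Implicit Types f : {ffun J -> IL * IR}.

(** One-site factors of the projector of outcome [f]. The sites of [P] carry right movers and the
    others left movers, which matches the sublattices of the circuit. *)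
Definition chargeop f (k : S) : 'M[R[i]]_d :=
  if P k then place gR (fun j => PR (f j).2) k
  else place gL (fun j => PL (f j).1) k.

Lemma chargeop_trmxC f k : (chargeop f k) ^t* = chargeop f k.
Proof.
have [PLh _ _ _] := PLres; have [PRh _ _ _] := PRres.
by rewrite /chargeop /place; case: ifP => _; case: pickP => [j _|_];
  rewrite /= ?PLh ?PRh ?trmx1 ?map_mx1.
Qed.

Lemma chargeop_idem f k : chargeop f k *m chargeop f k = chargeop f k.
Proof.
have [_ PLi _ _] := PLres; have [_ PRi _ _] := PRres.
by rewrite /chargeop /place; case: ifP => _; case: pickP => [j _|_];
  rewrite /= ?PLi ?PRi ?mulmx1.
Qed.

Hypotheses (gL_inj : injective gL) (gR_inj : injective gR).
Hypotheses (PgL : forall j, ~~ P (gL j)) (PgR : forall j, P (gR j)).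

Lemma prod_chargeop f (F : S -> 'M[R[i]]_d -> R[i]) :
  \prod_k F k (chargeop f k) =
  (\prod_j (F (gL j) (PL (f j).1) * F (gR j) (PR (f j).2))) *
  ((\prod_(k | P k && (k \notin codom gR)) F k 1%:M) *
   (\prod_(k | ~~ P k && (k \notin codom gL)) F k 1%:M)).
Proof.
rewrite (bigID P) /=.
under eq_bigr => k Pk do rewrite /chargeop Pk.
rewrite (prod_place _ F gR_inj PgR).
rewrite [X in _ * X](eq_bigr (fun k => F k (place gL (fun j => PL (f j).1) k))); last first.
  by move=> k /negbTE Pk; rewrite /chargeop Pk.
rewrite (@prod_place _ _ _ _ (fun k => ~~ P k) _ _ F gL_inj PgL) big_split /=.
by rewrite mulrACA [X in X * _]mulrC.
Qed.

(** In each matrix entry the sum over outcomes distributes over the labels, and each label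
    contributes the two resolutions of the identity. *)
Lemma sum_chargeop : \sum_f siteop (chargeop f) = 1%:M.
Proof.
have [_ _ _ PL1] := PLres; have [_ _ _ PR1] := PRres.
rewrite -siteop1; apply/matrixP => p q; rewrite summxE mxE.
set s := enum_val p; set s' := enum_val q.
pose F k (M : 'M[R[i]]_d) := M (s k) (s' k).
rewrite (eq_bigr (fun f => \prod_k F k (chargeop f k))); last first.
  by move=> f _; rewrite mxE.
under eq_bigr do rewrite prod_chargeop.
rewrite -mulr_suml.
rewrite -(bigA_distr_bigA (fun j ab => F (gL j) (PL ab.1) * F (gR j) (PR ab.2))).
rewrite [X in X * _](eq_bigr (fun j => F (gL j) 1%:M * F (gR j) 1%:M)); last first.
  move=> j _; rewrite -(pair_bigA _ (fun a b => F (gL j) (PL a) * F (gR j) (PR b))) /=.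
  rewrite (_ : F _ 1%:M = \sum_a F (gL j) (PL a)); last by rewrite /F -PL1 summxE.
  rewrite (_ : F _ 1%:M = \sum_b F (gR j) (PR b)); last by rewrite /F -PR1 summxE.
  by rewrite mulr_suml; under [RHS]eq_bigr do rewrite mulr_sumr.
rewrite [RHS](eq_bigr (fun k => F k (if P k then place gR (fun=> 1%:M) k
  else place gL (fun=> 1%:M) k))); last by move=> k _; rewrite !place1 if_same.
rewrite [RHS](bigID P) /=.
rewrite [X in _ = X * _](eq_bigr (fun k => F k (place gR (fun=> 1%:M) k))); last first.
  by move=> k ->.
rewrite [X in _ = _ * X](eq_bigr (fun k => F k (place gL (fun=> 1%:M) k))); last first.
  by move=> k /negbTE ->.
rewrite (prod_place _ F gR_inj PgR).
rewrite (@prod_place _ _ _ _ (fun k => ~~ P k) _ _ F gL_inj PgL) big_split /=.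
by rewrite [RHS]mulrACA [X in _ = X * _]mulrC.
Qed.

(** With one factor $1/d$ per site, sites without a projector contribute 1 and the others contribute
    marginals of the charge distribution. *)
Lemma mxtrace_chargeop f : (0 < d)%N ->
  \tr (siteop (chargeop f)) =
  d%:R ^+ #|S| * \prod_j (\tr (PL (f j).1) / d%:R * (\tr (PR (f j).2) / d%:R)).
Proof.
move=> d_gt0; have d_neq0 : d%:R != 0 :> R[i] by rewrite pnatr_eq0 -lt0n.
rewrite mxtrace_siteop.
rewrite (eq_bigr (fun k => d%:R * (\tr (chargeop f k) / d%:R))); last first.
  by move=> k _; rewrite mulrCA divff ?mulr1.
rewrite big_split /= prodr_const (prod_chargeop f (fun=> fun M => \tr M / d%:R)).
by rewrite [X in _ * (X * _)]big1 ?[X in _ * (_ * X)]big1 ?mulr1//;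
  move=> k _; rewrite mxtrace1 divff.
Qed.

End ChargeProjectors.

(** * Partial trace of pure states and its duality with local observables *)

Section PartialTrace.
Variables (R : realType) (S : finType) (d : nat) (A : {set S}).
Local Notation C := R[i].

(** The vector is reshaped into a matrix with rows indexed by configurations of [A] and columns by
    those of its complement. The sum in each entry has a single term, since the two restrictions
    determine a configuration. *)
Lemma partial_trace_pure (psi : 'cV[C]_#|config S d|) :
  exists B : 'M[C]_(#|config {k | k \in A} d|, #|config {k | k \in ~: A} d|),
    partial_trace A (psi *m psi ^t*) = B *m B ^t*.
Proof.
exists (\matrix_(p, e) \sum_(s : config S d | (restr A s == enum_val p)
  && (restr (~: A) s == enum_val e)) psi (enum_rank s) 0).
apply/matrixP => p q; rewrite [LHS]mxE [RHS]mxE.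
rewrite (partition_big (restr (~: A)) predT)//= -sum_enum_val.
apply: eq_bigr => e _; rewrite !mxE mulr_suml; apply: eq_bigr => s /andP[_ /eqP se].
rewrite rmorph_sum mulr_sumr; apply: eq_big => [s'|s' _]; first by rewrite se [enum_val e == _]eq_sym.
by rewrite mxE big_ord1 !mxE.
Qed.

Lemma prod_restr (M : S -> 'M[C]_d) (s s' : config S d) :
  (forall k, k \notin A -> M k = 1%:M) ->
  \prod_k M k (s' k) (s k) = (restr (~: A) s == restr (~: A) s')%:R *
    \prod_(k : {k | k \in A}) M (val k) (restr A s' k) (restr A s k).
Proof.
move=> M1; rewrite (bigID (mem A)) /= mulrC; congr (_ * _).
  rewrite eq_sym -prod_delta; under [RHS]eq_bigr do rewrite !ffunE.
  rewrite -(big_sub (mem (~: A)) (fun k => (s' k == s k)%:R)) /=.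
  by apply: eq_big => [k|k kA]; rewrite ?inE// M1// mxE.
under [RHS]eq_bigr do rewrite !ffunE.
by rewrite -(big_sub (mem A) (fun k => M k (s' k) (s k))).
Qed.

(** Outside [A] the identity factors force both configurations to agree, which is the condition
    summed over in [partial_trace]. *)
Lemma mxtrace_partial_trace (rho : 'M[C]_#|config S d|) (M : S -> 'M[C]_d) :
  (forall k, k \notin A -> M k = 1%:M) ->
  \tr (partial_trace A rho *m siteop (fun k : {k | k \in A} => M (val k))) =
  \tr (rho *m siteop M).
Proof.
move=> M1.
pose Y (v u : config {k : S | k \in A} d) := \prod_k M (val k) (v k) (u k).
have -> : \tr (rho *m siteop M) = \sum_(s : config S d) \sum_(s' : config S d |
   restr (~: A) s == restr (~: A) s') rho (enum_rank s) (enum_rank s') * Y (restr A s') (restr A s).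
  rewrite -sum_enum_val; apply: eq_bigr => p _; rewrite mxE.
  rewrite [RHS]big_mkcond -sum_enum_val; apply: eq_bigr => q _.
  rewrite mxE (prod_restr _ _ M1) !enum_valK.
  by case: ifP; rewrite ?mul1r// !mul0r mulr0.
rewrite (partition_big (restr A) predT)//= -sum_enum_val; apply: eq_bigr => p _.
rewrite mxE.
under [RHS]eq_bigr => s _ do rewrite (partition_big (restr A) predT)//= -sum_enum_val.
rewrite [RHS]exchange_big; apply: eq_bigr => q _.
rewrite !mxE mulr_suml; apply: eq_bigr => s /eqP sp.
rewrite mulr_suml; apply: eq_big => [s'|s' /andP[/eqP sq _]]; first by rewrite andbC.
by rewrite sp sq.
Qed.

End PartialTrace.

(** * Transport of charges by the circuit *)

Section Evolution.
Variables (R : realType) (d L : nat) (U : 'M[R[i]]_(d * d)).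
Local Notation site := 'I_(L.*2).
Hypotheses (d_gt0 : (0 < d)%N) (Uu : U \is unitarymx).

(** The chain has even length [L.*2], so parity alternates across the periodic boundary as well. *)
Lemma odd_ordS (k : site) : odd (ordS k) = ~~ odd k.
Proof. by rewrite /= odd_mod ?odd_double. Qed.

Lemma even_ordS (k : site) : ~~ odd (ordS k) = ~~ ~~ odd k.
Proof. by rewrite odd_ordS. Qed.

Lemma layer_isometry (P : pred site) : (forall k, P (ordS k) = ~~ P k) ->
  layer U P ^t* *m layer U P = 1%:M.
Proof. by move=> PS; apply: (gatelayer_isometry (@ordSK _) (@ord_predK _) PS). Qed.

Lemma brickwork_isometry t : (brickwork L U ^+ t) ^t* *m (brickwork L U ^+ t) = 1%:M.
Proof.
have W1 : brickwork L U ^t* *m brickwork L U = 1%:M.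
  rewrite /brickwork trmx_mul map_mxM/= -mulmxA [X in _ *m X]mulmxA.
  by rewrite (layer_isometry even_ordS) mul1mx (layer_isometry odd_ordS).
elim: t => [|t IH]; first by rewrite expr0 trmx1 map_mx1 mulmx1.
rewrite exprS trmx_mul map_mxM/= -mulmxA [X in _ *m X]mulmxA.
by rewrite W1 mul1mx.
Qed.

(** The gate swaps the two factors of each pair: [rt] moves one site right and [lf] one site left.
    Both change sublattice, as the next layer requires. *)
Lemma layer_soliton (P : pred site) lf rt : (forall k, P (ordS k) = ~~ P k) ->
  (forall k k', U *m (rt k *t lf k') = (lf k' *t rt k) *m U) ->
  layer U P *m siteop (fun k => if P k then rt k else lf k) =
  siteop (fun k => if P k then lf (ordS k) else rt (ord_pred k)) *m layer U P.
Proof.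
move=> PS U_swap; apply: (gatelayer_intertwine (@ordSK _) (@ord_predK _) PS) => // k Pk.
by rewrite PS Pk /= ordSK U_swap.
Qed.

(** A time step is two layers, hence [t.*2] shifts. The odd layer acts first and finds the right
    movers on the first site of its pairs. *)
Lemma brickwork_soliton lf rt t :
  (forall k k', U *m (rt k *t lf k') = (lf k' *t rt k) *m U) ->
  brickwork L U ^+ t *m siteop (fun k : site => if odd k then rt k else lf k) =
  siteop (fun k : site => if odd k then rt (iter t.*2 (@ord_pred _) k)
                   else lf (iter t.*2 (@ordS _) k)) *m brickwork L U ^+ t.
Proof.
move=> U_swap; elim: t => [|t IH].
  by rewrite expr0 mul1mx mulmx1.
rewrite exprS -mulmxA IH !mulmxA; congr (_ *m _).
rewrite /brickwork -mulmxA (layer_soliton odd_ordS) ?mulmxA; last by move=> k k'.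
rewrite (@eq_siteop _ _ _ _ (fun k : site => if ~~ odd k
  then rt (iter t.*2 (@ord_pred _) (ord_pred k))
  else lf (iter t.*2 (@ordS _) (ordS k)))); last by move=> k; case: ifP.
rewrite (@layer_soliton _ (fun k => lf (iter t.*2 (@ordS _) (ordS k)))
  (fun k => rt (iter t.*2 (@ord_pred _) (ord_pred k))) even_ordS) -?mulmxA; last by move=> k k'.
congr (_ *m _); apply: eq_siteop => k.
by rewrite if_neg doubleS !iterSr.
Qed.

(** Once the operator is carried back to time 0, the evolution cancels by isometry, and the
    expectation factorises over the initial Bell pairs. *)
Lemma evolved_expectation lf rt t :
  (forall k k', U *m (rt k *t lf k') = (lf k' *t rt k) *m U) ->
  \tr (evolved_state L U t *m (evolved_state L U t) ^t* *m
    siteop (fun k : site => if odd k then rt (iter t.*2 (@ord_pred _) k)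
                   else lf (iter t.*2 (@ordS _) k))) =
  \prod_(k : site | ~~ odd k)
    ((bell R d) ^t* *m (lf k *t rt (ordS k)) *m bell R d) 0 0.
Proof.
move=> U_swap; rewrite -mulmxA mxtrace_mulC /evolved_state.
rewrite -mulmxA [X in _ *m X]mulmxA -brickwork_soliton// trmx_mul map_mxM/=.
rewrite -!mulmxA (mulmxA ((brickwork L U ^+ t) ^t* )) brickwork_isometry mul1mx.
rewrite trace_mx11.
pose v0 (_ : site) := bell R d.
have -> : initial_state R d L = pairstate (fun k : site => ~~ odd k) (@ordS _) v0 by [].
rewrite (siteopE (@ordSK _) (@ord_predK _) even_ordS).
rewrite (gatelayer_mul_pairstate (@ordSK _) (@ord_predK _) even_ordS)//.
rewrite (pairstate_dot (@ordSK _) (@ord_predK _) even_ordS)//.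
by apply: eq_bigr => k kodd; rewrite (negbTE kodd) odd_ordS kodd mulmxA.
Qed.

End Evolution.

(** * Charge statistics of one Bell pair *)

Section ChargeDistribution.
Variables (R : realType) (d : nat).
Hypothesis d_gt0 : (0 < d)%N.
Local Notation C := R[i].

Lemma bellE i j :
  bell R d (mxtens_index (i, j)) 0 = ((Num.sqrt d%:R)^-1)%:C * (i == j)%:R.
Proof.
rewrite /bell mxE summxE; congr (_ * _).
under eq_bigr do rewrite mxE (can_eq (@mxtens_indexK _ _)) xpair_eqE andbT.
have [<-|ij] := eqVneq i j.
  by rewrite (bigD1 i)//= !eqxx big1 ?addr0// => k; rewrite eq_sym => /negbTE ->.
rewrite big1// => k _; have [<-|//] := eqVneq i k; by rewrite eq_sym (negbTE ij).
Qed.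

Lemma bell_trmxCE i j :
  (bell R d) ^t* 0 (mxtens_index (i, j)) = (((Num.sqrt d%:R)^-1)%:C * (i == j)%:R)^*%R.
Proof. by rewrite -bellE mxE [in LHS]mxE. Qed.

(** The right-hand side is $\mathrm{tr}(AB^T)/d$: a Bell pair carries an operator from one side to
    the other as its transpose. *)
Lemma bell_expectation (A B : 'M[C]_d) :
  ((bell R d) ^t* *m (A *t B) *m bell R d) 0 0 =
  d%:R^-1 * \sum_i \sum_j A i j * B i j.
Proof.
set a := ((Num.sqrt d%:R)^-1)%:C : C.
have aa : a^*%R * a = d%:R^-1.
  rewrite /a conj_Creal ?complex_real// -rmorphM -invfM -expr2 sqr_sqrtr ?ler0n//.
  by rewrite fmorphV rmorph_nat.
rewrite -mulmxA [LHS]mxE -sum_mxtens -aa mulr_sumr; apply: eq_bigr => i _.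
rewrite (bigD1 i)//= [X in _ + X]big1 ?addr0; last first.
  by move=> j ji; rewrite bell_trmxCE eq_sym (negbTE ji) mulr0 conjC0 mul0r.
rewrite bell_trmxCE eqxx mulr1 -/a mxE -sum_mxtens !mulr_sumr; apply: eq_bigr => j _.
rewrite (bigD1 j)//= [X in _ + X]big1 ?addr0; last first.
  by move=> k kj; rewrite bellE eq_sym (negbTE kj) !mulr0.
by rewrite tensmxE bellE eqxx mulr1 -/a; ring.
Qed.

Lemma bell_expectation1r (A : 'M[C]_d) :
  ((bell R d) ^t* *m (A *t 1%:M) *m bell R d) 0 0 = \tr A / d%:R.
Proof.
rewrite bell_expectation mulrC; congr (_ / _); apply: eq_bigr => i _.
rewrite (bigD1 i)//= mxE eqxx mulr1 big1 ?addr0// => j ji.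
by rewrite mxE eq_sym (negbTE ji) mulr0.
Qed.

Lemma bell_expectation1l (A : 'M[C]_d) :
  ((bell R d) ^t* *m (1%:M *t A) *m bell R d) 0 0 = \tr A / d%:R.
Proof.
rewrite -bell_expectation1r !bell_expectation; congr (_ * _).
by apply: eq_bigr => i _; apply: eq_bigr => j _; rewrite mulrC.
Qed.

Variables (IL IR : finType) (PL : IL -> 'M[C]_d) (PR : IR -> 'M[C]_d).
Hypotheses (PLres : projector_resolution PL) (PRres : projector_resolution PR).
Local Notation c := (charge_distr PL PR).

(** The expectation of the projector [X] is the squared norm of its image of the Bell vector, so
    taking the real part in [charge_distr] loses nothing. *)
Lemma charge_distrE a b :
  ((bell R d) ^t* *m (PL a *t PR b) *m bell R d) 0 0 = (c a b)%:C /\ 0 <= c a b.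
Proof.
apply: complex_ge0E.
have [PLh PLi _ _] := PLres; have [PRh PRi _ _] := PRres.
set X := PL a *t PR b.
have Xh : X ^t* = X by rewrite /X trmx_tens map_mxT/= PLh PRh.
have Xi : X *m X = X by rewrite /X tensmx_mul PLi PRi.
have -> : (bell R d) ^t* *m X *m bell R d =
    ((bell R d) ^t* *m X) *m ((bell R d) ^t* *m X) ^t*.
  by rewrite trmx_mul map_mxM/= trmxCK Xh !mulmxA -(mulmxA _ X X) Xi.
exact: mulmx_trmxC_ge0.
Qed.

Lemma charge_distr_ge0 a b : 0 <= c a b.
Proof. by case: (charge_distrE a b). Qed.

Lemma charge_marginalL a : (\sum_b c a b)%:C = \tr (PL a) / d%:R.
Proof.
have [_ _ _ PR1] := PRres.
rewrite rmorph_sum -bell_expectation1r bell_expectation -PR1.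
rewrite (eq_bigr _ (fun b _ => esym (charge_distrE a b).1)).
under eq_bigr do rewrite bell_expectation.
rewrite -mulr_sumr exchange_big; congr (_ * _); apply: eq_bigr => i _.
rewrite exchange_big; apply: eq_bigr => j _.
by rewrite summxE mulr_sumr.
Qed.

Lemma charge_marginalR b : (\sum_a c a b)%:C = \tr (PR b) / d%:R.
Proof.
have [_ _ _ PL1] := PLres.
rewrite rmorph_sum -bell_expectation1l bell_expectation -PL1.
rewrite (eq_bigr _ (fun a _ => esym (charge_distrE a b).1)).
under eq_bigr do rewrite bell_expectation.
rewrite -mulr_sumr exchange_big; congr (_ * _); apply: eq_bigr => i _.
rewrite exchange_big; apply: eq_bigr => j _.
by rewrite summxE mulr_suml.
Qed.

Lemma sum_charge_distr : \sum_a \sum_b c a b = 1.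
Proof.
have [_ _ _ PL1] := PLres; apply: (@complexI R).
rewrite rmorph_sum rmorph1; rewrite (eq_bigr _ (fun a _ => charge_marginalL a)).
by rewrite -mulr_suml -raddf_sum PL1 /= mxtrace1 divff// pnatr_eq0 -lt0n.
Qed.

End ChargeDistribution.

(** * Entropy sums for independent, identically distributed pairs *)

Section IndependentPairs.
Variables (R : realType).

Lemma ln_prod (J : finType) (F : J -> R) : (forall j, 0 < F j) ->
  ln (\prod_j F j) = \sum_j ln (F j).
Proof.
move=> F_gt0; apply: (@proj2 (0 < \prod_j F j)).
elim/big_rec2: (_) => [|j s p _ [p_gt0 <-]]; first by rewrite ltr01 ln1.
by rewrite mulr_gt0// lnM ?posrE.
Qed.

Variables (I J : finType) (K : finType) (c : I -> J -> R).
Hypotheses (c_ge0 : forall a b, 0 <= c a b) (c1 : \sum_a \sum_b c a b = 1).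
Local Notation cL := (fun a => \sum_b c a b).
Local Notation cR := (fun b => \sum_a c a b).

(** As a mean over the outcomes of one pair, the mutual information adds up over independent
    pairs. *)
Lemma mutual_infoE : mutual_info c =
  \sum_(p : I * J) c p.1 p.2 * (ln (c p.1 p.2) - ln (cL p.1) - ln (cR p.2)).
Proof.
rewrite -(pair_bigA _ (fun a b => c a b * (ln (c a b) - ln (cL a) - ln (cR b)))) /=.
rewrite /mutual_info.
have -> : \sum_b cR b * ln (cR b) = \sum_a \sum_b c a b * ln (cR b).
  by rewrite exchange_big; apply: eq_bigr => b _; rewrite mulr_suml.
rewrite -!sumrB; apply: eq_bigr => a _.
rewrite mulr_suml -!sumrB; apply: eq_bigr => b _; by rewrite !mulrBr.
Qed.

(** Linearity of expectation: in the [j]-th term every factor but the [j]-th sums to 1. *)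
Lemma sum_iid_additive (h : I * J -> R) :
  \sum_(f : {ffun K -> I * J}) (\prod_j c (f j).1 (f j).2) * (\sum_j h (f j)) =
  #|K|%:R * \sum_p c p.1 p.2 * h p.
Proof.
under eq_bigr do rewrite mulr_sumr.
rewrite exchange_big /= mulr_natl -sumr_const; apply: eq_bigr => j _.
pose F i p := c p.1 p.2 * (if i == j then h p else 1).
rewrite (eq_bigr (fun f : {ffun K -> I * J} => \prod_i F i (f i))); last first.
  by move=> f _; rewrite /F big_split /= -[X in _ = _ * X]big_mkcond big_pred1_eq.
rewrite -bigA_distr_bigA (bigD1 j)//= [X in _ * X]big1 ?mulr1.
  by apply: eq_bigr => p _; rewrite /F eqxx.
move=> i /negbTE ij; rewrite /F ij; under eq_bigr do rewrite mulr1.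
by rewrite -(pair_bigA _ (fun a b => c a b)).
Qed.

Lemma sum_iid_relative_entropy (D0 : R) : 0 < D0 ->
  let p (f : {ffun K -> I * J}) := \prod_j c (f j).1 (f j).2 in
  \sum_f p f * (ln (D0 * \prod_j (cL (f j).1 * cR (f j).2)) - ln (p f)) =
  ln D0 - #|K|%:R * mutual_info c.
Proof.
move=> D0_gt0 /=.
pose h q := ln (c q.1 q.2) - ln (cL q.1) - ln (cR q.2).
rewrite (eq_bigr (fun f : {ffun K -> I * J} => ln D0 * (\prod_j c (f j).1 (f j).2)
   - (\prod_j c (f j).1 (f j).2) * \sum_j h (f j))); last first.
  move=> f _; rewrite [ln D0 * _]mulrC -mulrBr.
  (* Outcomes of probability zero contribute nothing; for the others all [c] and marginals involved
     are positive, so the logarithms split. *)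
  have [->|p_neq0] := eqVneq (\prod_j c (f j).1 (f j).2) 0; first by rewrite !mul0r.
  have c_gt0 j : 0 < c (f j).1 (f j).2.
    by rewrite lt_def c_ge0 andbT; move/prodf_neq0: p_neq0; apply.
  have cL_gt0 j : 0 < cL (f j).1.
    by rewrite (bigD1 (f j).2)//= ltr_pwDl// sumr_ge0.
  have cR_gt0 j : 0 < cR (f j).2.
    by rewrite (bigD1 (f j).1)//= ltr_pwDl// sumr_ge0.
  congr (_ * _); rewrite lnM ?posrE//; last by rewrite prodr_gt0// => j _; rewrite mulr_gt0.
  rewrite !ln_prod//; last by move=> j; rewrite mulr_gt0.
  rewrite -addrA; congr (_ + _); rewrite -sumrB -sumrN; apply: eq_bigr => j _.
  by rewrite lnM ?posrE// /h; ring.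
rewrite sumrB -mulr_sumr sum_iid_additive mutual_infoE.
rewrite -(bigA_distr_bigA (fun (_ : K) q => c q.1 q.2)) big1 ?mulr1// => j _.
by rewrite -(pair_bigA _ (fun a b => c a b)).
Qed.

End IndependentPairs.

(** * Position and number of the Bell pairs shared by the two intervals *)

Section Geometry.

(** Here [u] is the first and [n] the number of integers $y$ with $1\le y\le\ell$ and $\ell+x+1\le
    y+2t\le2\ell+x$. A left mover at $y$ has its partner at $y+2t+1/2$. *)
Lemma overlap_window (R : realType) (l x t : nat) :
  x%:R / 2 < t%:R :> R -> t%:R < x%:R / 2 + l%:R :> R ->
  exists n u : nat,
    [/\ n%:R = l%:R - `|2 * t%:R - (x%:R + l%:R)| :> R, (0 < u)%N,
       (u + n <= l.+1)%N, (l + x < u + t.*2)%N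
     & (u + n + t.*2 <= (2 * l + x).+1)%N].
Proof.
move=> h1 h2.
have lt1 : (x < t.*2)%N.
  by rewrite -(ltr_nat R) -muln2 natrM; lra.
have lt2 : (t.*2 < x + l.*2)%N.
  by rewrite -(ltr_nat R) natrD -!muln2 !natrM; lra.
(* The sign inside the absolute value decides which constraint sets the first $y$: the lower bound 1
   from $2t=x+\ell$ on, and $\ell+x+1-2t$ before. *)
have [le|gt] := leqP (x + l) t.*2.
  exists (2 * l + x - t.*2)%N, 1%N; split; try lia.
  rewrite ger0_norm; last first.
    by move: le; rewrite -(ler_nat R) natrD -muln2 natrM; lra.
  rewrite natrB; last by lia.
  by rewrite natrD -muln2 !natrM; lra.
exists (t.*2 - x)%N, (l + x + 1 - t.*2)%N; split; try lia.
rewrite ltr0_norm; last first.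
  by move: gt; rewrite -(ltr_nat R) natrD -muln2 natrM; lra.
by rewrite natrB ?(ltnW lt1)// -muln2 natrM; lra.
Qed.

Lemma card_two_intervals_le L l x : (#|two_intervals L l x| <= 4 * l)%N.
Proof.
pose s := iota 2 l.*2 ++ iota (l + x + 1).*2 l.*2.
have -> : (4 * l)%N = size s by rewrite size_cat !size_iota; lia.
rewrite cardE -(size_map (@nat_of_ord _)); apply: uniq_leq_size.
  by rewrite map_inj_uniq ?enum_uniq//; apply: val_inj.
move=> _ /mapP[k + ->]; rewrite mem_enum inE mem_cat !mem_iota.
by lia.
Qed.

Lemma val_iter_ordS N n (k : 'I_N) : (k + n < N)%N -> val (iter n (@ordS N) k) = (k + n)%N.
Proof.
elim: n => [|n IH] kn; first by rewrite addn0.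
by rewrite /= IH ?modn_small ?addnS//; lia.
Qed.

Lemma val_iter_ord_pred N n (k : 'I_N) : (n <= k)%N ->
  val (iter n (@ord_pred N) k) = (k - n)%N.
Proof.
elim: n => [|n IH] kn; first by rewrite subn0.
have kN := ltn_ord k.
rewrite /= IH; last by lia.
rewrite (_ : (k - n + N).-1 = k - n.+1 + N)%N; last by lia.
by rewrite modnDr modn_small; lia.
Qed.

End Geometry.

(** * Exchange relations of a charged gate *)

Section ChargedGate.
Variables (R : realType) (d : nat).
Local Notation C := R[i].

Lemma tensmx_suml (I : finType) (F : I -> 'M[C]_d) (B : 'M[C]_d) :
  (\sum_a F a) *t B = \sum_a F a *t B.
Proof.
apply/matrixP => p q; rewrite mxE !summxE mulr_suml.
by apply: eq_bigr => a _; rewrite mxE.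
Qed.

Lemma tensmx_sumr (I : finType) (F : I -> 'M[C]_d) (B : 'M[C]_d) :
  B *t (\sum_a F a) = \sum_a B *t F a.
Proof.
apply/matrixP => p q; rewrite mxE !summxE mulr_sumr.
by apply: eq_bigr => a _; rewrite mxE.
Qed.

(** Summing the charge relation over one family turns its projector into the identity, which [None]
    denotes; this covers sites where no charge is measured. *)
Lemma charged_swap (IL IR : finType) (U : 'M[C]_(d * d))
    (PL : IL -> 'M[C]_d) (PR : IR -> 'M[C]_d) (b : option IL) (a : option IR) :
  charged_gate U PL PR ->
  U *m (oapp PR 1%:M a *t oapp PL 1%:M b) = (oapp PL 1%:M b *t oapp PR 1%:M a) *m U.
Proof.
move=> [[_ _ _ PL1] [_ _ _ PR1] UP].
have UP1 a' : U *m (PR a' *t 1%:M) = (1%:M *t PR a') *m U.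
  rewrite -PL1 tensmx_sumr tensmx_suml mulmx_sumr mulmx_suml.
  by apply: eq_bigr => b' _.
case: a b => [a|] [b|] //=.
  rewrite -PR1 tensmx_sumr tensmx_suml mulmx_sumr mulmx_suml.
  by apply: eq_bigr => a' _.
by rewrite tensmx1 mul1mx mulmx1.
Qed.

End ChargedGate.

(** * Measuring the shared charges inside the two intervals *)

Theorem theorem2 (R : realType) (d : nat) (U : 'M[R[i]]_(d * d))
    (IL IR : finType) (PL : IL -> 'M[R[i]]_d) (PR : IR -> 'M[R[i]]_d)
    (L l x t : nat) :
  (2 <= d)%N ->
  dual_unitary U ->
  charged_gate U PL PR ->
  (0 < l)%N -> (0 < x)%N -> (0 < t)%N ->
  (l < x)%N ->
  (4 * (l + x + t) <= L)%N ->
  x%:R / 2 < t%:R :> R ->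
  t%:R < x%:R / 2 + l%:R :> R ->
  vN_entropy (reduced_state U t (two_intervals L l x))
  <= 4 * l%:R * ln d%:R
     - (l%:R - `|2 * t%:R - (x%:R + l%:R)|) * mutual_info (charge_distr PL PR).
Proof.
move=> d_gt1 [Uu _] Ucharged l_gt0 x_gt0 t_gt0 lx hL ht1 ht2.
have d_gt0 : (0 < d)%N by lia.
have [PLres PRres _] := Ucharged.
have [n [u [<- u_gt0 un lu unt]]] := overlap_window ht1 ht2.
set A := two_intervals L l x.
have gP (j : 'I_n) : ((u + j + t).*2 < L.*2)%N by have := ltn_ord j; lia.
(* The [j]-th pair starts at position $u+j+t$, with qudits [gL0 j] and [gR0 j]. By time [t] its
   charges have moved [t.*2] labels apart from there, to [gL j] on the left and [gR j] on the
   right. *)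
pose gL0 j : 'I_(L.*2) := Ordinal (gP j).
pose gR0 j := ordS (gL0 j).
pose gL j := iter t.*2 (@ord_pred _) (gL0 j).
pose gR j := iter t.*2 (@ordS _) (gR0 j).
have val_gR0 j : val (gR0 j) = (u + j + t).*2.+1.
  by rewrite /= modn_small//; have := ltn_ord j; lia.
have val_gL j : val (gL j) = (u + j).*2 by rewrite val_iter_ord_pred /=; lia.
have val_gR j : val (gR j) = ((u + j + t).*2.+1 + t.*2)%N.
  by rewrite val_iter_ordS -[nat_of_ord (gR0 j)]/(val _) val_gR0//;
    have := ltn_ord j; lia.
have gLA j : gL j \in A.
  by rewrite inE -[nat_of_ord _]/(val _) val_gL; have := ltn_ord j; lia.
have gRA j : gR j \in A.
  by rewrite inE -[nat_of_ord _]/(val _) val_gR; have := ltn_ord j; lia.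
have gL0_inj : injective gL0 by move=> j j' /(congr1 val)/= ?; apply: val_inj => /=; lia.
have gL_inj : injective gL.
  by move=> j j' /(congr1 val); rewrite !val_gL => ?; apply: val_inj => /=; lia.
have gR_inj : injective gR.
  by move=> j j' /(congr1 val); rewrite !val_gR => ?; apply: val_inj => /=; lia.
pose gLA' j : {k | k \in A} := exist _ (gL j) (gLA j).
pose gRA' j : {k | k \in A} := exist _ (gR j) (gRA j).
have gLA_inj : injective gLA' by move=> j j' /(congr1 val)/gL_inj.
have gRA_inj : injective gRA' by move=> j j' /(congr1 val)/gR_inj.
have odd_gL j : ~~ odd (gL j) by rewrite -[nat_of_ord _]/(val _) val_gL; lia.
have odd_gR j : odd (gR j) by rewrite -[nat_of_ord _]/(val _) val_gR; lia.
pose odd_site (k : {k | k \in A}) := odd (val k).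
pose c := charge_distr PL PR.
pose p (f : {ffun 'I_n -> IL * IR}) := \prod_j c (f j).1 (f j).2.
pose D (f : {ffun 'I_n -> IL * IR}) := d%:R ^+ #|{: {k | k \in A}}| *
  \prod_j ((\sum_b c (f j).1 b) * (\sum_a c a (f j).2)).
have [B rhoB] := partial_trace_pure A (evolved_state L U t).
rewrite /reduced_state rhoB.
apply: (le_trans (@vN_entropy_le_measurement _ _ _ _ _
  (fun f => siteop (chargeop PL PR odd_site gLA' gRA' f)) p D _ _ _ _ _)).
- move=> f; rewrite siteop_trmxC; apply: eq_siteop => k; exact: chargeop_trmxC.
- move=> f; rewrite siteop_mul; apply: eq_siteop => k; exact: chargeop_idem.
- exact: sum_chargeop.
- move=> f.
  pose lf := place gL0 (fun j => PL (f j).1).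
  pose rt := place gR0 (fun j => PR (f j).2).
  (* Sites of [A] are compared through their labels, so the projector on [A] is by conversion the
     restriction of one on the chain. *)
  have -> : siteop (chargeop PL PR odd_site gLA' gRA' f) =
      siteop (fun k : {k | k \in A} => chargeop PL PR (fun k : 'I_(L.*2) => odd k) gL gR f (val k)) by [].
  rewrite -rhoB mxtrace_partial_trace; last first.
    move=> k kA; rewrite /chargeop; case: ifP => _; apply: place_out => j;
      by apply: contraNneq kA => <-.
  (* Placing at the shifted sites amounts to placing at the initial sites and shifting the argument
     back. *)
  rewrite (@eq_siteop _ _ _ _ (fun k : 'I_(L.*2) =>
    if odd k then rt (iter t.*2 (@ord_pred _) k) else lf (iter t.*2 (@ordS _) k))); last first.
    have iterSK m : cancel (iter m (@ordS L.*2)) (iter m (@ord_pred _)).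
      by elim: m => // m IH k; rewrite iterSr iterS ordSK IH.
    have iter_predK m : cancel (iter m (@ord_pred L.*2)) (iter m (@ordS _)).
      by elim: m => // m IH k; rewrite iterSr iterS ord_predK IH.
    move=> k; rewrite /chargeop /lf /rt /place.
    case: ifP => _; congr (oapp _ _ _); apply: eq_pick => j /=.
      exact: (can2_eq (iterSK _) (iter_predK _)).
    exact: (can2_eq (iter_predK _) (iterSK _)).
  rewrite (evolved_expectation d_gt0 Uu (lf := lf) (rt := rt)); last first.
    move=> k k'; rewrite /rt /lf /place.
    by case: pickP => [j _|_]; case: pickP => [j' _|_] /=;
      [ exact: (charged_swap (Some _) (Some _) Ucharged)
      | exact: (charged_swap None (Some _) Ucharged)
      | exact: (charged_swap (Some _) None Ucharged)
      | exact: (charged_swap None None Ucharged)].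
  (* Both ends of a Bell pair carry the same label, as [gR0] is the right neighbour of [gL0]. A
     selected pair contributes its value of [c], any other pair the norm 1. *)
  pose F (_ : 'I_(L.*2)) o : R[i] := ((bell R d) ^t* *m
     (oapp (fun j => PL (f j).1) 1%:M o *t oapp (fun j => PR (f j).2) 1%:M o)
     *m bell R d) 0 0.
  rewrite (eq_bigr (fun k => F k [pick j | gL0 j == k])); last first.
    move=> k _; rewrite /F /lf /rt /place.
    rewrite (_ : [pick j | gR0 j == ordS k] = [pick j | gL0 j == k])//.
    by apply: eq_pick => j /=; rewrite (can_eq (@ordSK _)).
  rewrite (prod_pick (P := fun k : 'I_(L.*2) => ~~ odd k) F gL0_inj); last first.
    by move=> j; rewrite /= odd_double.
  rewrite [X in _ * X]big1 ?mulr1; last first.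
    move=> k _; rewrite /F /= bell_expectation1r// mxtrace1 divff//.
    by rewrite pnatr_eq0 -lt0n.
  rewrite rmorph_prod; apply: eq_bigr => j _.
  by rewrite /F /= (charge_distrE PLres PRres _ _).1.
- move=> f; rewrite mxtrace_chargeop//.
  rewrite /D rmorphM rmorphXn rmorph_nat rmorph_prod; congr (_ * _).
  apply: eq_bigr => j _.
  by rewrite rmorphM -(charge_marginalL PLres PRres) -(charge_marginalR PLres PRres).
rewrite (sum_iid_relative_entropy 'I_n (charge_distr_ge0 PLres PRres)
  (sum_charge_distr d_gt0 PLres PRres)) ?exprn_gt0 ?ltr0n// card_ord.
(* What remains is $|A|\ln d\le4\ell\ln d$, where $\ln d\ge0$. *)
apply: lerB => //; rewrite card_sig lnXn ?ltr0n// -[leLHS]mulr_natl.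
apply: ler_wpM2r; first by rewrite ln_ge0// ler1n.
by rewrite -natrM ler_nat card_two_intervals_le.
Qed.
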